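(* Let $U\neq\emptyset$ be a set and let $F,G\colon U\to\mathbb{R}\cup\{+\infty\}$ be functions such that $F+G\not\equiv+\infty$. For $\alpha\in[0,+\infty)$ let $H_\alpha\colon U\to\mathbb{R}\cup\{+\infty\}$, $H_\alpha(u):=F(u)+\alpha G(u)$, and let $H_\alpha^\star:=\arg\min_{u\in U}H_\alpha(u)\subset U$. Then, for all but at most countably many $\alpha\in[0,+\infty)$, we have: if $H_\alpha^\star\neq\emptyset$, then $$\inf_{u\in H_\alpha^\star}G(u)=\sup_{u\in H_\alpha^\star}G(u).$$
   Context: $\arg\min_{u\in U}H_\alpha(u)$ is the (possibly empty) set of points of $U$ at which $H_\alpha$ attains its infimum over $U$. No structure on $U$ is assumed. Infima and suprema are taken in $[-\infty,+\infty]$. Convention: $0\cdot(+\infty)=0$, i.e. $H_0=F$. *)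

(* Defs.v *)
From HB Require Import structures.
From mathcomp Require Import all_boot all_order all_algebra.
From mathcomp Require Import all_classical all_reals all_analysis.

Set Implicit Arguments.
Unset Strict Implicit.
Unset Printing Implicit Defensive.

Import Order.TTheory GRing.Theory Num.Theory.
Local Open Scope classical_set_scope.
Local Open Scope ring_scope.
Local Open Scope ereal_scope.

(* The value +oo is allowed: if f is identically +oo, every point is a
   minimizer. *)
Definition argmin (R : realType) (U : Type) (f : U -> \bar R) : set U :=
  [set u | f u = ereal_inf (range f)].

(* In [\bar R] one has 0 * +oo = 0, so [penalized F G 0 = F]. *)
Definition penalized (R : realType) (U : Type) (F G : U -> \bar R) (a : R)
    : U -> \bar R :=
  fun u => F u + a%:E * G u.

(* Main.v *)
(* Minimizers are antitone in the penalty: if [a < b], [u] minimizes [F + a G]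
   and [v] minimizes [F + b G], then adding the two minimality inequalities
   gives [G v <= G u].  So the open intervals between two values of [G] on the
   argmin sets of distinct positive exceptional parameters are disjoint, and
   choosing a rational in each enumerates these parameters. *)

Require Import Defs.
From HB Require Import structures.
From mathcomp Require Import all_boot all_order all_algebra.
From mathcomp Require Import all_classical all_reals all_analysis.
From mathcomp Require Import lra.

Set Implicit Arguments.
Unset Strict Implicit.
Unset Printing Implicit Defensive.

Import Order.TTheory GRing.Theory Num.Theory.
Local Open Scope classical_set_scope.
Local Open Scope ring_scope.
Local Open Scope ereal_scope.

Lemma countableU (T : Type) (A B : set T) :
  countable A -> countable B -> countable (A `|` B).
Proof.
move=> cA cB; rewrite -bigcup2E; apply: bigcup_countable => //.
by move=> [|[|i]] _ /=.
Qed.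

Lemma argmin_le (R : realType) (U : Type) (f : U -> \bar R) (u w : U) :
  argmin f u -> f u <= f w.
Proof. by rewrite /argmin /= => ->; apply: ereal_inf_lbound; exists w. Qed.

(** If no two values of [G] on [A] were strictly ordered, the image would be a singleton, whose
    infimum and supremum agree. On the empty set they are [+oo] and [-oo], hence the
    nonemptiness. *)
Lemma ereal_inf_neq_sup_image (R : realType) (U : Type) (G : U -> \bar R)
    (A : set U) :
  A !=set0 -> ereal_inf (G @` A) <> ereal_sup (G @` A) ->
  exists u v, [/\ A u, A v & G u < G v].
Proof.
move=> [u Au] neq; apply: contrapT => noex; apply: neq.
have cst v w : A v -> A w -> G v <= G w.
  by move=> Av Aw; rewrite leNgt; apply/negP => lt; apply: noex; exists w, v.
suff -> : G @` A = [set G u] by rewrite ereal_inf1 ereal_sup1.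
apply/seteqP; split=> [_ [v Av <-]|_ ->]; last by exists u.
by apply/eqP; rewrite eq_le !cst.
Qed.

Section penalized_argmin.
Variables (R : realType) (U : Type) (F G : U -> \bar R).
Hypotheses (hF : forall u, F u != -oo) (hG : forall u, G u != -oo).
Hypothesis hFG : exists u, F u + G u != +oo.

(** A point where [F + G] is finite bounds the minimum by a real number, while an infinite [F u] or
    [G u] would make the penalized value [+oo]. For [a = 0] this fails for [G u], since
    [0 * +oo = 0]. *)
Lemma argmin_penalized_fin (a : R) (u : U) :
  (0 < a)%R -> argmin (penalized F G a) u ->
  exists x y : R, F u = x%:E /\ G u = y%:E.
Proof.
move=> a0 mu; have [w hw] := hFG; move: (argmin_le w mu).
rewrite /penalized; move: (hF u) (hG u) (hF w) (hG w) hw.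
case: (F w) => [x'| |] //; case: (G w) => [y'| |] // => Fu Gu _ _ _.
case: (F u) Fu => [x| |] //; case: (G u) Gu => [y| |] // _ _; first by exists x, y.
all: by rewrite ?gt0_muley ?lte_fin // leye_eq.
Qed.

Lemma argmin_penalized_anti (a b : R) (u v : U) :
  (0 < a < b)%R -> argmin (penalized F G a) u -> argmin (penalized F G b) v ->
  G v <= G u.
Proof.
move=> /andP[a0 ab] mu mv; have b0 := lt_trans a0 ab.
(* With all four values real, the [F] terms cancel when the inequalities are added. *)
have [x [y [Fu Gu]]] := argmin_penalized_fin a0 mu.
have [x' [y' [Fv Gv]]] := argmin_penalized_fin b0 mv.
move: (argmin_le v mu) (argmin_le u mv).
rewrite /penalized Fu Gu Fv Gv -!EFinM -!EFinD !lee_fin => h1 h2.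
have : ((b - a) * y' <= (b - a) * y)%R by lra.
by rewrite ler_pM2l // subr_gt0.
Qed.

Lemma countable_argmin_penalized_gap :
  countable [set a : R | (0 < a)%R /\ exists u v,
    [/\ argmin (penalized F G a) u, argmin (penalized F G a) v & G u < G v]].
Proof.
set B := [set a | _].
(* The implication sits under the existential so that [choice] yields a total function [q]; outside
   [B] its value is a dummy [0]. *)
have sep a : exists q : rat, B a -> exists u v,
    [/\ argmin (penalized F G a) u, argmin (penalized F G a) v,
        G u < (ratr q)%:E & (ratr q)%:E < G v].
  have [[a0 [u [v [mu mv uv]]]]|nBa] := pselect (B a); last by exists 0%R.
  have [x [y [_ Gu]]] := argmin_penalized_fin a0 mu.
  have [x' [y' [_ Gv]]] := argmin_penalized_fin a0 mv.
  move: uv; rewrite Gu Gv lte_fin => /rat_in_itvoo[q].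
  rewrite in_itv /= => /andP[yq qy'].
  by exists q => _; exists u, v; rewrite Gu Gv !lte_fin.
have [q qP] := choice sep.
(* Take the lower point [u] at [a] and the upper point [v] at [b]: [q b < G v <= G u < q a]. *)
have q_anti a b : B a -> B b -> (a < b)%R -> (q b < q a)%R.
  move=> Ba Bb ab; have [u [_ [mu _ uq _]]] := qP _ Ba.
  have [_ [v [_ mv _ qv]]] := qP _ Bb.
  have /argmin_penalized_anti/(_ mu mv) vu : (0 < a < b)%R by rewrite Ba.1.
  by rewrite -(ltr_rat R) -lte_fin (lt_trans qv) // (le_lt_trans vu).
apply/countable_injP; exists (pickle \o q) => a b; rewrite !inE => Ba Bb /=.
move=> /(pcan_inj pickleK) qab.
by case: (ltgtP a b) => // lt; [have := q_anti _ _ Ba Bb lt|have := q_anti _ _ Bb Ba lt];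
  rewrite qab ltxx.
Qed.

End penalized_argmin.

Theorem corollary3p3 (R : realType) (U : Type) (F G : U -> \bar R)
    (hU : inhabited U)
    (hF : forall u, F u != -oo) (hG : forall u, G u != -oo)
    (hFG : exists u, F u + G u != +oo) :
  countable [set a : R | (0 <= a)%R /\
    ~ (argmin (penalized F G a) !=set0 ->
       ereal_inf (G @` argmin (penalized F G a)) =
       ereal_sup (G @` argmin (penalized F G a)))].
Proof.
have gap := countable_argmin_penalized_gap hF hG hFG.
(* The parameter [0], where minimizers may have infinite [G], is set aside as a single extra
   point. *)
have := countableU (countable1 0%R) gap.
apply: sub_countable; apply: subset_card_le => a [a0 /not_implyP[ne neq]].
move: a0; rewrite le_eqVlt => /predU1P[<-|a0]; first by left.
by right; split=> //; exact: ereal_inf_neq_sup_image.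
Qed.
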